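(* Let $\Bbbk$ be an algebraically closed field and let $G\subset \mathrm{Bir}(\mathbb{P}^2)$ be a nontrivial normal subgroup of the group $\mathrm{Bir}(\mathbb{P}^2)$ of birational maps $\mathbb{P}^2\dashrightarrow\mathbb{P}^2$ over $\Bbbk$. Then the centralizer of $G$ in $\mathrm{Bir}(\mathbb{P}^2)$ is trivial: $C_{\mathrm{Bir}(\mathbb{P}^2)}(G)=\{\mathrm{id}\}$.
   Context: $\mathbb{P}^2$ is the projective plane over $\Bbbk$. $C_{\mathrm{Bir}(\mathbb{P}^2)}(G)$ is the set of $f\in\mathrm{Bir}(\mathbb{P}^2)$ with $fg=gf$ for all $g\in G$. *)

(* Defs.v *)
From HB Require Import structures.
From mathcomp Require Import all_boot all_algebra.
From mathcomp Require Import mpoly.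

Set Implicit Arguments.
Unset Strict Implicit.
Unset Printing Implicit Defensive.

Import GRing.Theory.
Local Open Scope ring_scope.

(* A triple f of forms of the same degree, not all zero, represents the       *)
(* rational map [x_0 : x_1 : x_2] |-> [f_0 : f_1 : f_2] from the projective   *)
(* plane to itself.  The forms may have a common factor, and two triples      *)
(* represent the same rational map when they are proportional over the field  *)
(* of fractions.                                                              *)
Notation triple k := (3.-tuple {mpoly k[3]}).

Section RationalMaps.
Variable k : fieldType.
Implicit Types f g h : triple k.

Definition nonzero f := [exists i, tnth f i != 0].

(* The common degree of the entries of f, if f is homogeneous and nonzero. *)
Definition tdeg f := (\max_(i < 3) msize (tnth f i)).-1.

Definition is_ratmap f :=
  nonzero f && [forall i, tnth f i \is (tdeg f).-homog].

Definition proportional f g :=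
  [forall i, forall j, tnth f i * tnth g j == tnth f j * tnth g i].

Definition tid : triple k := [tuple 'X_i | i < 3].

Definition tcomp f g : triple k := [tuple tnth f i \mPo g | i < 3].

(* f o g is the identity; the nonvanishing says that the image of g is not    *)
(* contained in the common zero locus of the triple f.                        *)
Definition comp_is_id f g :=
  nonzero (tcomp f g) && proportional (tcomp f g) tid.

Lemma is_ratmapP f :
  reflect ((exists i, tnth f i != 0) /\
           (exists d, forall i, tnth f i \is d.-homog))
          (is_ratmap f).
Proof.
apply: (iffP andP) => [[/existsP nz_f /forallP hf] | [nz_f [d hf]]].
  by split=> //; exists (tdeg f).
split; first exact/existsP.
have szf i : tnth f i != 0 -> msize (tnth f i) = d.+1.
  move=> nz_i; have := dhomog_uniq nz_i (hf i) (dhomog_msize (hf i)).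
  by move=> ->; rewrite prednK // lt0n msize_poly_eq0.
suff -> : tdeg f = d by apply/forallP.
rewrite /tdeg; case: nz_f => i nz_i.
suff -> : \max_(i < 3) msize (tnth f i) = d.+1 by [].
apply/eqP; rewrite eqn_leq; apply/andP; split; last first.
  by rewrite -(szf i nz_i) (leq_bigmax i).
apply/bigmax_leqP => j _; have [->|nz_j] := eqVneq (tnth f j) 0.
  by rewrite msize0.
by rewrite szf.
Qed.

Lemma nonzeroP f : reflect (exists i, tnth f i != 0) (nonzero f).
Proof. exact: existsP. Qed.

Lemma proportionalP f g :
  reflect (forall i j, tnth f i * tnth g j = tnth f j * tnth g i)
          (proportional f g).
Proof.
apply: (iffP forallP) => [H i j | H i]; first exact/eqP/(forallP (H i)).
by apply/forallP => j; apply/eqP.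
Qed.

Lemma proportional_refl : reflexive proportional.
Proof. by move=> f; apply/proportionalP => i j; rewrite mulrC. Qed.

Lemma proportional_sym : ssrbool.symmetric proportional.
Proof.
suff s f g : proportional f g -> proportional g f.
  by move=> f g; apply/idP/idP => /s.
by move/proportionalP=> H; apply/proportionalP => i j; rewrite mulrC -H mulrC.
Qed.

Lemma proportional_trans g f h : nonzero g ->
  proportional f g -> proportional g h -> proportional f h.
Proof.
case/nonzeroP=> l nz_l /proportionalP Hfg /proportionalP Hgh.
apply/proportionalP => i j; apply: (mulfI nz_l).
rewrite mulrA [_ * tnth f i]mulrC Hfg -mulrA Hgh mulrA Hfg.
by rewrite mulrA [tnth g l * _]mulrC.
Qed.

Lemma tnth_tcomp f g i : tnth (tcomp f g) i = tnth f i \mPo g.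
Proof. by rewrite tnth_mktuple. Qed.

Lemma tcompA f g h : tcomp f (tcomp g h) = tcomp (tcomp f g) h.
Proof.
apply: eq_from_tnth => i; rewrite !tnth_tcomp.
rewrite [tnth f i \mPo g]comp_mpolyEX comp_mpolyEX raddf_sum /=.
apply: eq_bigr => m _; rewrite linearZ /=; congr (_ *: _).
rewrite !comp_mpolyX rmorph_prod /=.
by apply: eq_bigr => j _; rewrite rmorphXn /= tnth_tcomp.
Qed.

Lemma tcompf1 f : tcomp f tid = f.
Proof. by apply: eq_from_tnth => i; rewrite tnth_tcomp comp_mpoly_id. Qed.

Lemma tcomp1f f : tcomp tid f = f.
Proof.
apply: eq_from_tnth => i.
by rewrite tnth_tcomp tnth_mktuple comp_mpolyXU -tnth_nth.
Qed.

Lemma comp_dhomog d e (p : {mpoly k[3]}) g : p \is d.-homog ->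
  (forall i, tnth g i \is e.-homog) -> p \mPo g \is (e * d).-homog.
Proof.
move=> /dhomogP hp hg; rewrite comp_mpolyEX big_seq rpred_sum // => m m_p.
have <- : mdeg m = d by exact: hp.
apply: rpredZ; rewrite comp_mpolyX mdegE big_distrr /=.
apply: (big_rec2 (fun a b => a \is b.-homog)); first exact: dhomog1.
by move=> i a b _ hb; apply: dhomogM => //; apply: dhomogMn.
Qed.

Lemma comp_scale d (p c : {mpoly k[3]}) g g' : p \is d.-homog ->
  (forall i, tnth g' i = c * tnth g i) -> p \mPo g' = c ^+ d * (p \mPo g).
Proof.
move=> /dhomogP hp hg; rewrite !comp_mpolyEX big_distrr /=.
rewrite big_seq [RHS]big_seq; apply: eq_bigr => m m_p.
have <- : mdeg m = d by exact: hp.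
rewrite -scalerAr; congr (_ *: _); rewrite !comp_mpolyX mdegE.
rewrite -prodrXr -big_split /=.
by apply: eq_bigr => i _; rewrite hg exprMn.
Qed.

Lemma tcomp_propl f f' g :
  proportional f f' -> proportional (tcomp f g) (tcomp f' g).
Proof.
move/proportionalP=> H; apply/proportionalP => i j.
by rewrite !tnth_tcomp -!rmorphM /= H.
Qed.

Lemma tcomp_propr f g g' : is_ratmap f -> nonzero g -> nonzero g' ->
  proportional g g' -> proportional (tcomp f g) (tcomp f g').
Proof.
move=> /is_ratmapP[_ [d hf]] /nonzeroP[l nz_l] /nonzeroP[l' nz_l'].
move/proportionalP=> H; have nz'_l : tnth g' l != 0.
  apply/eqP => g'l0; move: (H l l'); rewrite g'l0 mulr0 => /eqP.
  by rewrite mulf_eq0 (negPf nz_l) (negPf nz_l').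
pose s := [tuple tnth g l * tnth g' i | i < 3].
have sE i : tnth f i \mPo s = tnth g l ^+ d * (tnth f i \mPo g').
  by apply: comp_scale => // j; rewrite tnth_mktuple.
have sE' i : tnth f i \mPo s = tnth g' l ^+ d * (tnth f i \mPo g).
  by apply: comp_scale => // j; rewrite tnth_mktuple H mulrC.
apply/proportionalP => i j; rewrite !tnth_tcomp.
have nz : tnth g l ^+ d != 0 by rewrite expf_neq0.
apply: (mulfI nz); rewrite mulrCA [RHS]mulrCA -!sE !sE'.
by rewrite mulrCA [RHS]mulrCA; congr (_ * _); rewrite mulrC.
Qed.

Lemma comp_is_idP f g : reflect
  (exists2 c, c != 0 & forall i, tnth (tcomp f g) i * 'X_ord0 = c * 'X_i)
  (comp_is_id f g).
Proof.
have nzX (i : 'I_3) : 'X_i != 0 :> {mpoly k[3]}.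
  by rewrite -msize_poly_eq0 msizeX.
apply: (iffP andP) => [[/nonzeroP[i nz_i] /proportionalP H]|[c nz_c H]].
  have E j : tnth (tcomp f g) j * 'X_ord0 = tnth (tcomp f g) ord0 * 'X_j.
    by have := H j ord0; rewrite !tnth_mktuple.
  exists (tnth (tcomp f g) ord0) => //; apply/eqP => z.
  move: (E i); rewrite z mul0r => /eqP.
  by rewrite mulf_eq0 (negPf nz_i) (negPf (nzX _)).
split.
  apply/nonzeroP; exists ord0; rewrite (mulIf (nzX ord0) (H ord0)) //.
apply/proportionalP => i j; rewrite [tnth tid _]tnth_mktuple.
rewrite [tnth tid _]tnth_mktuple; apply: (mulIf (nzX ord0)).
by rewrite mulrAC H [RHS]mulrAC H mulrAC.
Qed.

Lemma ratmap_nonzero f : is_ratmap f -> nonzero f.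
Proof. by case/andP. Qed.

Lemma tid_ratmap : is_ratmap tid.
Proof.
apply/is_ratmapP; split; first exists ord0; rewrite ?tnth_mktuple.
  by rewrite -msize_poly_eq0 msizeX.
by exists 1%N => i; rewrite tnth_mktuple dhomogX; apply/eqP/mdeg1.
Qed.

Lemma comp_is_id1 : comp_is_id tid tid.
Proof.
by rewrite /comp_is_id tcomp1f proportional_refl ratmap_nonzero ?tid_ratmap.
Qed.

Lemma tcomp_homog f g : is_ratmap f -> is_ratmap g ->
  nonzero (tcomp f g) -> is_ratmap (tcomp f g).
Proof.
move=> /is_ratmapP[_ [d hf]] /is_ratmapP[_ [e hg]] nz.
apply/is_ratmapP; split; first exact/nonzeroP.
by exists (e * d)%N => i; rewrite tnth_tcomp; apply: comp_dhomog.
Qed.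

(* A rational map with a right inverse is dominant. *)
Lemma tcomp_ratmap f g g' : is_ratmap f -> is_ratmap g ->
  comp_is_id g g' -> is_ratmap (tcomp f g).
Proof.
move=> rf rg /comp_is_idP[c nz_c H]; apply: tcomp_homog => //.
have /is_ratmapP[[i nz_i] [d hf]] := rf.
apply/nonzeroP; exists i; rewrite tnth_tcomp; apply: contraNneq nz_i => z.
have nzX : 'X_ord0 != 0 :> {mpoly k[3]} by rewrite -msize_poly_eq0 msizeX.
pose s := [tuple 'X_ord0 * tnth (tcomp g g') i | i < 3].
have s1 : tnth f i \mPo s = 'X_ord0 ^+ d * (tnth f i \mPo tcomp g g').
  by apply: comp_scale => // j; rewrite tnth_mktuple.
have s2 : tnth f i \mPo s = c ^+ d * (tnth f i \mPo tid).
  by apply: comp_scale => // j; rewrite !tnth_mktuple mulrC -H tnth_tcomp.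
have := s1; rewrite s2 comp_mpoly_id.
have -> : tnth f i \mPo tcomp g g' = 0.
  by rewrite -tnth_tcomp tcompA tnth_tcomp tnth_tcomp z comp_mpoly0.
by move/eqP; rewrite mulr0 mulf_eq0 expf_eq0 (negPf nz_c) andbF.
Qed.

End RationalMaps.

(* A birational map together with its inverse, both given by triples.  When g *)
(* is birational, tcomp f g never vanishes (tcomp_ratmap) and its class only  *)
(* depends on those of f and g (birepM_eq).                                   *)
Record birep (k : fieldType) := Birep {
  birep_val : triple k * triple k;
  _ : [&& is_ratmap birep_val.1, is_ratmap birep_val.2,
          comp_is_id birep_val.1 birep_val.2 &
          comp_is_id birep_val.2 birep_val.1] }.

HB.instance Definition _ k := [isSub for @birep_val k].
HB.instance Definition _ k := [Choice of birep k by <:].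

Section Bir.
Variable k : fieldType.
Implicit Types u v w : birep k.

Definition fwd u := (val u).1.
Definition bwd u := (val u).2.

Lemma fwdP u : is_ratmap (fwd u). Proof. by case/and4P: (valP u) => H _ _ _. Qed.
Lemma bwdP u : is_ratmap (bwd u). Proof. by case/and4P: (valP u) => _ H _ _. Qed.
Lemma fwdK u : comp_is_id (bwd u) (fwd u). Proof. by case/and4P: (valP u) => _ _ _ H. Qed.
Lemma bwdK u : comp_is_id (fwd u) (bwd u). Proof. by case/and4P: (valP u) => _ _ H _. Qed.

Definition birep_eq u v := proportional (fwd u) (fwd v).

Lemma birep_eq_refl : reflexive birep_eq.
Proof. by move=> u; apply: proportional_refl. Qed.

Lemma birep_eq_sym : ssrbool.symmetric birep_eq.
Proof. by move=> u v; apply: proportional_sym. Qed.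

Lemma birep_eq_trans : transitive birep_eq.
Proof. by move=> v u w; apply/proportional_trans/ratmap_nonzero/fwdP. Qed.

Canonical birep_equiv :=
  EquivRel birep_eq birep_eq_refl birep_eq_sym birep_eq_trans.

(* The inverse being determined by the map, only the maps are compared. *)
Definition Bir := {eq_quot birep_equiv}%qT.
HB.instance Definition _ := Choice.on Bir.
HB.instance Definition _ : EqQuotient _ birep_equiv Bir := EqQuotient.on Bir.

Lemma bir1_proof : let u := (tid k, tid k) in
  [&& is_ratmap u.1, is_ratmap u.2, comp_is_id u.1 u.2 & comp_is_id u.2 u.1].
Proof. by rewrite /= tid_ratmap comp_is_id1. Qed.

Definition birep1 := Birep bir1_proof.

Lemma birV_proof v : let u := (bwd v, fwd v) in
  [&& is_ratmap u.1, is_ratmap u.2, comp_is_id u.1 u.2 & comp_is_id u.2 u.1].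
Proof. by rewrite /= fwdP bwdP fwdK bwdK. Qed.

Definition birepV v := Birep (birV_proof v).

Lemma comp_is_idM (f f' g g' : triple k) :
  is_ratmap f -> is_ratmap g -> is_ratmap f' -> is_ratmap g' ->
  comp_is_id f f' -> comp_is_id f' f -> comp_is_id g g' -> comp_is_id g' g ->
  comp_is_id (tcomp f g) (tcomp g' f').
Proof.
move=> rf rg rf' rg' ff' f'f gg' g'g.
have nz : nonzero (tcomp g g') by case/andP: gg'.
have rgg : is_ratmap (tcomp g g') := tcomp_homog rg rg' nz.
have nz2 : is_ratmap (tcomp (tcomp g g') f') := tcomp_ratmap rgg rf' f'f.
have pr : proportional (tcomp (tcomp g g') f') f'.
  rewrite -[X in proportional _ X]tcomp1f; apply: tcomp_propl.
  by case/andP: gg'.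
have pr2 : proportional (tcomp (tcomp f g) (tcomp g' f')) (tcomp f f').
  rewrite -tcompA [tcomp g _]tcompA.
  exact: (tcomp_propr rf (ratmap_nonzero nz2) (ratmap_nonzero rf') pr).
apply/andP; split.
  have r2 := tcomp_ratmap (tcomp_ratmap rf rg gg') rg' g'g.
  by rewrite tcompA; apply: ratmap_nonzero (tcomp_ratmap r2 rf' f'f).
by case/andP: ff' => nzff'; apply: proportional_trans pr2.
Qed.

Lemma birM_proof v w :
  let u := (tcomp (fwd v) (fwd w), tcomp (bwd w) (bwd v)) in
  [&& is_ratmap u.1, is_ratmap u.2, comp_is_id u.1 u.2 & comp_is_id u.2 u.1].
Proof.
rewrite /= (tcomp_ratmap (fwdP v) (fwdP w) (bwdK w)).
rewrite (tcomp_ratmap (bwdP w) (bwdP v) (fwdK v)) /=.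
by rewrite !comp_is_idM ?fwdP ?bwdP ?fwdK ?bwdK.
Qed.

Definition birepM v w := Birep (birM_proof v w).

Lemma birepM_eq u u' v v' :
  birep_eq u u' -> birep_eq v v' -> birep_eq (birepM u v) (birepM u' v').
Proof.
move=> uu' vv'; apply: (birep_eq_trans (y := birepM u' v)).
  exact: tcomp_propl.
by apply: tcomp_propr => //; rewrite ?ratmap_nonzero ?fwdP.
Qed.

Lemma birepMA u v w : birep_eq (birepM u (birepM v w)) (birepM (birepM u v) w).
Proof. by rewrite /birep_eq /= /fwd /= -/(fwd _) tcompA proportional_refl. Qed.

Lemma birep1M u : birep_eq (birepM birep1 u) u.
Proof. by rewrite /birep_eq /fwd /= -/(fwd _) tcomp1f proportional_refl. Qed.

Lemma birepM1 u : birep_eq (birepM u birep1) u.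
Proof. by rewrite /birep_eq /fwd /= -/(fwd _) tcompf1 proportional_refl. Qed.

Lemma birepVM u : birep_eq (birepM (birepV u) u) birep1.
Proof. by case/andP: (fwdK u). Qed.

Lemma birepMV u : birep_eq (birepM u (birepV u)) birep1.
Proof. by case/andP: (bwdK u). Qed.

Lemma birepV_eq u v : birep_eq u v -> birep_eq (birepV u) (birepV v).
Proof.
move=> uv; have c : birep_eq (birepM u (birepV v)) birep1.
  exact: birep_eq_trans (birepM_eq uv (birep_eq_refl (birepV v))) (birepMV v).
pose w := birepM (birepV u) (birepM u (birepV v)).
have wu : birep_eq w (birepV u).
  exact: birep_eq_trans (birepM_eq (birep_eq_refl (birepV u)) c) (birepM1 _).
have wv : birep_eq w (birepV v).
  have e := birepM_eq (birepVM u) (birep_eq_refl (birepV v)).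
  exact: birep_eq_trans (birepMA _ _ _) (birep_eq_trans e (birep1M _)).
by rewrite birep_eq_sym in wu; exact: birep_eq_trans wu wv.
Qed.

Local Open Scope quotient_scope.

Definition bir1 : Bir := \pi_Bir birep1.
Definition birM (x y : Bir) : Bir := \pi_Bir (birepM (repr x) (repr y)).
Definition birV (x : Bir) : Bir := \pi_Bir (birepV (repr x)).

Lemma Bir_eqP u v : reflect (\pi_Bir u = \pi_Bir v) (birep_eq u v).
Proof. exact: (iffP (eqmodP _ _ _)). Qed.

Lemma birep_eq_repr u : birep_eq (repr (\pi_Bir u)) u.
Proof. by apply/Bir_eqP; rewrite reprK. Qed.

Lemma birME u v : birM (\pi_Bir u) (\pi_Bir v) = \pi_Bir (birepM u v).
Proof. by apply/Bir_eqP/birepM_eq; apply: birep_eq_repr. Qed.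

Lemma birVE u : birV (\pi_Bir u) = \pi_Bir (birepV u).
Proof. by apply/Bir_eqP/birepV_eq/birep_eq_repr. Qed.

Lemma birMA : associative birM.
Proof.
move=> x y z; rewrite -[x]reprK -[y]reprK -[z]reprK.
rewrite (birME (repr y)) (birME _ (birepM _ _)) (birME (repr x)) birME.
exact: (elimT (Bir_eqP _ _) (birepMA (repr x) (repr y) (repr z))).
Qed.

Lemma bir1M : left_id bir1 birM.
Proof.
move=> x; rewrite -[x]reprK birME.
exact: (elimT (Bir_eqP _ _) (birep1M _)).
Qed.

Lemma birM1 : right_id bir1 birM.
Proof.
move=> x; rewrite -[x]reprK birME.
exact: (elimT (Bir_eqP _ _) (birepM1 _)).
Qed.

Lemma birVM : left_inverse bir1 birV birM.
Proof.
move=> x; rewrite -[x]reprK birVE birME.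
exact: (elimT (Bir_eqP _ _) (birepVM _)).
Qed.

Lemma birMV : right_inverse bir1 birV birM.
Proof.
move=> x; rewrite -[x]reprK birVE birME.
exact: (elimT (Bir_eqP _ _) (birepMV _)).
Qed.

HB.instance Definition _ :=
  isGroup.Build Bir birMA bir1M birM1 birVM birMV.

End Bir.

(* Subsets are Prop-valued, so that no decidability is assumed. *)
Section Subgroups.
Local Open Scope group_scope.
Variable T : groupType.
Implicit Types G : T -> Prop.

Definition subgroup G : Prop :=
  [/\ G 1, forall x y, G x -> G y -> G (x * y) & forall x, G x -> G x^-1].

Definition normal_subgroup G : Prop :=
  subgroup G /\ forall x y, G x -> G (x ^ y).

Definition nontrivial G : Prop := exists2 x, G x & x <> 1.

Definition centralizer G : T -> Prop :=
  fun f => forall g, G g -> f * g = g * f.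

End Subgroups.

(* Main.v *)
Require Import Defs.
From mathcomp Require Import all_boot all_algebra.
From mathcomp Require Import mpoly ring.

(* Conjugating by linear maps already suffices: if f and g are nontrivial,    *)
(* some linear conjugate of g does not commute with f.  Choose points p and q *)
(* moved by f and g, put p' = f(p), and choose r and q' generic.  For every   *)
(* m != 0 there is a linear A with q |-> p, g(q) |-> r and q' |-> m p'.  If f *)
(* commutes with A g A^-1, evaluating at p shows that f(r) is proportional to *)
(* A g(q') = a p + c r + b m p', where a, b, c are the coordinates of g(q')   *)
(* in the basis q, g(q), q', and b, c are nonzero.  Two values of m give two  *)
(* different points, a contradiction.                                         *)

Set Implicit Arguments.
Unset Strict Implicit.
Unset Printing Implicit Defensive.
Import GRing.Theory.
Local Open Scope ring_scope.

(** By normality, an element [f] of the centralizer commutes with every conjugate of a nontrivial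
    [g] in the subgroup, and [commute_conj_trivial] shows that only the identity does so. Rational
    maps are evaluated by [ev] on row vectors, a base point giving the zero vector. Each genericity
    requirement is then the nonvanishing of a polynomial function; several hold at once by
    [mpoly_nonroot] and [polyfun_nonroot2], which is how [general_position] finds q and q'.
    [commute_ev] evaluates the commutation at p. The coordinates of f(r) in the basis p, r, p' do
    not depend on m, yet must be proportional to (a, c, b m), which is impossible for two values of
    m. *)

(** * Nonvanishing of polynomials in several variables *)

Lemma muni_eq0 n (R : comNzRingType) (p : {mpoly R[n.+1]}) :
  muni p = 0 -> p = 0.
Proof.
pose t (m : 'X_{1..n.+1}) := [multinom m (widen_ord (leqnSn n) i) | i < n].
(* A monomial is determined by its last exponent and its truncation, so distinct terms of [p] cannot
   cancel in [muni p]. *)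
have tI m m' : t m = t m' -> m ord_max = m' ord_max -> m = m'.
  move=> /mnmP tE mE; apply/mnmP=> i.
  have [->//|ne] := eqVneq i ord_max.
  have ltin : (i < n)%N.
    by move: (ltn_ord i) ne; rewrite ltnS leq_eqVlt -val_eqE /= => /orP[->|].
  have := tE (Ordinal ltin); rewrite !mnmE.
  by congr (m _ = m' _); apply: val_inj.
move=> p0; apply/mpolyP=> m; rewrite mcoeff0.
have [m_p|/memN_msupp_eq0 //] := boolP (m \in msupp p).
have /(congr1 (fun q : {poly _} => (q`_(m ord_max))@_(t m))) := p0.
rewrite coef0 mcoeff0 => <-; rewrite muniE coef_sum raddf_sum /=.
rewrite (bigD1_seq m) //= big1 ?addr0 => [|m' ne].
  by rewrite coefZ coefXn eqxx mulr1 mcoeffZ mcoeffX eqxx mulr1.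
rewrite coefZ coefXn; case: eqVneq => [eqm|_]; last by rewrite mulr0 mcoeff0.
rewrite mulr1 mcoeffZ mcoeffX; case: eqP => [eqt|_]; last by rewrite mulr0.
by rewrite (tI _ _ eqt (esym eqm)) eqxx in ne.
Qed.

Lemma muni_horner n (R : comNzRingType) (p : {mpoly R[n.+1]}) v :
  let w i := v (widen_ord (leqnSn n) i) in
  p.@[v] = (map_poly (meval w) (muni p)).[v ord_max].
Proof.
move=> w; rewrite muniE mevalE raddf_sum horner_sum /=.
apply: eq_bigr => m _; rewrite map_polyZ map_polyXn hornerZ hornerXn.
rewrite /= mevalZ mevalX big_ord_recr /= mulrA; congr (_ * _ * _).
by apply: eq_bigr => i _; rewrite mnmE.
Qed.

(** Induction on the number of variables: specialize the first ones so that the leading coefficient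
    in the last variable survives, then avoid the roots of the resulting univariate polynomial. *)
Lemma mpoly_nonroot (k : closedFieldType) n (p : {mpoly k[n]}) :
  p != 0 -> exists v, p.@[v] != 0.
Proof.
elim: n p => [p|n IHn p] nz_p.
  exists (fun=> 0); move: nz_p; rewrite [p]nvar0_mpolyC mevalC.
  by apply: contra => /eqP->.
have /eqP : muni p <> 0 by move/muni_eq0/eqP; apply/negP.
rewrite -lead_coef_eq0 lead_coefE; set j := _.-1 => /IHn[v nz_v].
have : map_poly (meval v) (muni p) != 0.
  apply: contraNneq nz_v => /(congr1 (fun q : {poly _} => q`_j)).
  by rewrite coef_map coef0 => ->.
case/closed_nonrootP=> x; rewrite /root => nz_x.
exists (fun i => if unlift ord_max i is Some j then v j else x).
rewrite muni_horner unlift_none; apply: contra nz_x => /eqP <-; apply/eqP.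
congr (_.[_]); apply: eq_map_poly => q; apply: meval_eq => i.
have -> : widen_ord (leqnSn n) i = lift ord_max i.
  by apply: val_inj; rewrite /= /bump leqNgt ltn_ord.
by rewrite liftK.
Qed.

Lemma mpoly_nonroot_row (k : closedFieldType) n (p : {mpoly k[n]}) :
  p != 0 -> exists v : 'rV_n, p.@[v 0] != 0.
Proof.
case/mpoly_nonroot=> v nz_v; exists (\row_i v i).
by apply: contra nz_v => /eqP <-; apply/eqP/meval_eq => i; rewrite mxE.
Qed.

(** * Polynomial functions on affine space *)

Section PolynomialFunctions.
Variables (k : closedFieldType) (n : nat).
Implicit Types phi psi : 'rV[k]_n -> k.

Definition polyfun phi := exists p : {mpoly k[n]}, forall v, phi v = p.@[v 0].

Lemma polyfun_meval p : polyfun (fun v => p.@[v 0]).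
Proof. by exists p. Qed.

Lemma polyfun_cst c : polyfun (fun=> c).
Proof. by exists c%:MP => v; rewrite mevalC. Qed.

Lemma polyfun_coord i : polyfun (fun v => v 0 i).
Proof. by exists 'X_i => v; rewrite mevalXU. Qed.

Lemma polyfunD phi psi :
  polyfun phi -> polyfun psi -> polyfun (fun v => phi v + psi v).
Proof. by move=> [p E] [q E']; exists (p + q) => v; rewrite mevalD E E'. Qed.

Lemma polyfunM phi psi :
  polyfun phi -> polyfun psi -> polyfun (fun v => phi v * psi v).
Proof. by move=> [p E] [q E']; exists (p * q) => v; rewrite mevalM E E'. Qed.

Lemma polyfunB phi psi :
  polyfun phi -> polyfun psi -> polyfun (fun v => phi v - psi v).
Proof. by move=> [p E] [q E']; exists (p - q) => v; rewrite mevalB E E'. Qed.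

(* Affine space over an infinite field is irreducible. *)
Lemma polyfun_nonroot2 phi psi : polyfun phi -> polyfun psi ->
    (exists v, phi v != 0) -> (exists v, psi v != 0) ->
  exists v, phi v != 0 /\ psi v != 0.
Proof.
move=> [p E] [q E'] [v nz_p] [w nz_q].
have nz (r : {mpoly k[n]}) u : r.@[u] != 0 -> r != 0.
  by apply: contraNneq => ->; rewrite meval0.
have : p * q != 0.
  apply: mulf_neq0; first by apply: (nz _ (v 0)); rewrite -E.
  by apply: (nz _ (w 0)); rewrite -E'.
case/mpoly_nonroot_row=> u; rewrite mevalM mulf_eq0 negb_or => /andP[nz1 nz2].
by exists u; rewrite E E'.
Qed.

End PolynomialFunctions.

(** * Bases of the space of row vectors, and changes of basis *)

Section Frames.
Variable k : fieldType.
Implicit Types x y z u : 'rV[k]_3.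

Definition frame x y z : 'M[k]_3 := \matrix_(i < 3) nth 0 [:: x; y; z] i.

Lemma mul_frame (a : 'rV[k]_3) x y z :
  a *m frame x y z = a 0 0 *: x + a 0 1 *: y + a 0 2%:R *: z.
Proof.
rewrite mulmx_sum_row !big_ord_recl big_ord0 addr0 !rowK /= addrA.
by congr (a 0 _ *: _ + a 0 _ *: _ + a 0 _ *: _); apply: val_inj.
Qed.

Lemma det_frame x y z : \det (frame x y z) =
  x 0 0 * (y 0 1 * z 0 2%:R - y 0 2%:R * z 0 1)
  - x 0 1 * (y 0 0 * z 0 2%:R - y 0 2%:R * z 0 0)
  + x 0 2%:R * (y 0 0 * z 0 1 - y 0 1 * z 0 0).
Proof.
do 3!rewrite ?(expand_det_row _ ord0) !big_ord_recl !big_ord0 /cofactor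
             ?det_mx00 !mxE /=.
(* The expansion produces lifted indices; passing to natural numbers lets [ring] identify equal
   ones. *)
pose c (u : 'rV[k]_3) j := u 0 (inord j : 'I_3).
have cE u i : u 0 i = c u i by rewrite /c inord_val.
by rewrite !cE /= /bump /=; ring.
Qed.

Lemma frame_inj (x y z : 'rV[k]_3) (a b c : k) : \det (frame x y z) != 0 ->
  a *: x + b *: y + c *: z = 0 -> [/\ a = 0, b = 0 & c = 0].
Proof.
rewrite -unitfE -unitmxE => Mu E.
pose v : 'rV[k]_3 := \row_i nth 0 [:: a; b; c] i.
have : v *m frame x y z = 0 by rewrite mul_frame !mxE.
move/(congr1 (mulmx^~ (invmx (frame x y z)))).
rewrite mulmxK // mul0mx => /rowP v0.
by have := (v0 0, v0 1, v0 2%:R); rewrite !mxE /= => -[[]].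
Qed.

(** For nonzero vectors this is equality of projective points; the zero vector, the value at a base
    point, is parallel to everything. *)
Definition parallel x y := forall i j, x 0 i * y 0 j = x 0 j * y 0 i.

Lemma parallelP x y : parallel x y -> y != 0 -> exists c, x = c *: y.
Proof.
move=> xy /rV0Pn[i nz]; exists (x 0 i / y 0 i); apply/rowP=> j.
by rewrite mxE mulrAC xy mulfK.
Qed.

Lemma det_frame_rot x y z : \det (frame x y z) = \det (frame y z x).
Proof. by rewrite !det_frame; ring. Qed.

Lemma det_frame_swap x y z : \det (frame x y z) = - \det (frame x z y).
Proof. by rewrite !det_frame; ring. Qed.

Lemma det_frameZ x y z c : \det (frame x y (c *: z)) = c * \det (frame x y z).
Proof. by rewrite !det_frame !mxE; ring. Qed.

(** Up to sign, the determinants completed by unit vectors are the 2 by 2 minors of [x] and [y]; if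
    all vanish, the vectors are parallel. *)
Lemma frame_completion x y :
  ~ parallel x y -> exists z, \det (frame x y z) != 0.
Proof.
move=> nxy; have [/existsP[j nz]|/existsPn det0] :=
  boolP [exists j, \det (frame x y (delta_mx 0 j)) != 0].
  by exists (delta_mx 0 j).
case: nxy.
have minor0 s t j : s - t = \det (frame x y (delta_mx 0 j)) -> s = t.
  by move=> E; apply: subr0_eq; rewrite E; apply/eqP/negPn.
have e01 : x 0 0 * y 0 1 = x 0 1 * y 0 0.
  by apply: (minor0 _ _ 2%:R); rewrite det_frame !mxE /=; ring.
have e02 : x 0 0 * y 0 2%:R = x 0 2%:R * y 0 0.
  by apply/esym/(minor0 _ _ 1); rewrite det_frame !mxE /=; ring.
have e12 : x 0 1 * y 0 2%:R = x 0 2%:R * y 0 1.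
  by apply: (minor0 _ _ 0); rewrite det_frame !mxE /=; ring.
have ordE (i : 'I_3) : [|| i == 0, i == 1 | i == 2%:R] by case: i => -[|[|[|]]].
move=> i j; case/or3P: (ordE i) => /eqP->; case/or3P: (ordE j) => /eqP->;
  by rewrite ?e01 ?e02 ?e12.
Qed.

Lemma parallelZr x y c : c != 0 -> parallel x (c *: y) -> parallel x y.
Proof.
move=> nz xy i j; apply: (mulfI nz).
by have := xy i j; rewrite !mxE mulrCA => ->; rewrite mulrCA.
Qed.

Lemma mul_frame_change x y z x' y' z' a b c : \det (frame x y z) != 0 ->
  (a *: x + b *: y + c *: z) *m (invmx (frame x y z) *m frame x' y' z') =
  a *: x' + b *: y' + c *: z'.
Proof.
rewrite -unitfE -unitmxE => Mu.
pose v : 'rV[k]_3 := \row_i nth 0 [:: a; b; c] i.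
have vE x1 y1 z1 : v *m frame x1 y1 z1 = a *: x1 + b *: y1 + c *: z1.
  by rewrite mul_frame !mxE.
by rewrite -!vE mulmxA mulmxK.
Qed.

Lemma frame_coord x y z u : \det (frame x y z) != 0 ->
  exists a b c, u = a *: x + b *: y + c *: z.
Proof.
rewrite -unitfE -unitmxE => Mu; pose a := u *m invmx (frame x y z).
by exists (a 0 0), (a 0 1), (a 0 2%:R); rewrite -mul_frame mulmxKV.
Qed.

End Frames.

(** * Evaluation of rational maps, and linear maps *)

Section Evaluation.
Variable k : fieldType.
Implicit Types (f g : triple k) (v : 'rV[k]_3).

Definition ev f v : 'rV[k]_3 := \row_i (tnth f i).@[v 0].

Lemma ev_tcomp f g v : ev (tcomp f g) v = ev f (ev g v).
Proof.
apply/rowP=> i; rewrite !mxE tnth_tcomp comp_mpoly_meval.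
by apply: meval_eq => j; rewrite mxE.
Qed.

Lemma ev_homog f : is_ratmap f ->
  exists d, forall c v, ev f (c *: v) = c ^+ d *: ev f v.
Proof.
case/is_ratmapP=> _ [d hf]; exists d => c v; apply/rowP=> i; rewrite !mxE.
have /dhomogP hi := hf i; rewrite !mevalE big_distrr /= big_seq [RHS]big_seq.
apply: eq_bigr => m /hi <-; rewrite mulrCA /= mdegE -prodrXr -big_split /=.
by congr (_ * _); apply: eq_bigr => j _; rewrite mxE exprMn.
Qed.

Lemma ev_proportional f g v : proportional f g -> parallel (ev f v) (ev g v).
Proof. by move=> /proportionalP E i j; rewrite !mxE -!mevalM E. Qed.

(** The composite is the identity only up to the rational factor c / x_0, whose denominator is
    cleared here. *)
Lemma ev_comp_is_id f g : comp_is_id f g -> exists2 c : {mpoly k[3]},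
  c != 0 & forall v, v 0 0 *: ev f (ev g v) = c.@[v 0] *: v.
Proof.
case/comp_is_idP=> c nz H; exists c => // v; apply/rowP=> i; rewrite -ev_tcomp.
have /(congr1 (meval (v 0))) := H i.
by rewrite !mevalM !mevalXU !mxE mulrC.
Qed.

(** Matrices act on row vectors from the right, hence the reversed product in [tcomp_tlin]. *)
Definition tlin (A : 'M[k]_3) : triple k :=
  [tuple \sum_i A i j *: 'X_i | j < 3].

Lemma ev_tlin A v : ev (tlin A) v = v *m A.
Proof.
apply/rowP=> j; rewrite !mxE tnth_mktuple raddf_sum /=.
by apply: eq_bigr => i _; rewrite mevalZ mevalXU mulrC.
Qed.

Lemma tlin1 : tlin 1%:M = tid k.
Proof.
apply: eq_from_tnth => j; rewrite !tnth_mktuple (bigD1 j) //= big1 ?addr0.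
  by rewrite mxE eqxx scale1r.
by move=> i /negPf ne; rewrite mxE ne scale0r.
Qed.

Lemma tcomp_tlin A B : tcomp (tlin A) (tlin B) = tlin (B *m A).
Proof.
apply: eq_from_tnth => j; rewrite tnth_tcomp !tnth_mktuple raddf_sum /=.
under eq_bigr do
  rewrite linearZ /= comp_mpolyXU -tnth_nth tnth_mktuple scaler_sumr.
rewrite exchange_big; apply: eq_bigr => l _; rewrite mxE scaler_suml.
by apply: eq_bigr => i _; rewrite scalerA mulrC.
Qed.

Lemma comp_is_id_tlin A B : B *m A = 1%:M -> comp_is_id (tlin A) (tlin B).
Proof.
move=> BA; have := comp_is_id1 k.
by rewrite /comp_is_id tcomp_tlin BA tlin1 tcomp1f.
Qed.

Lemma tlin_ratmap A B : B *m A = 1%:M -> is_ratmap (tlin A).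
Proof.
move=> BA; apply/is_ratmapP; split; last first.
  exists 1%N => j; rewrite tnth_mktuple rpred_sum // => i _.
  by rewrite rpredZ // dhomogX; apply/eqP/mdeg1.
have /andP[/nonzeroP[i nz] _] := comp_is_id_tlin BA.
exists i; apply: contraNneq nz.
by rewrite tnth_tcomp => ->; rewrite comp_mpoly0.
Qed.

Lemma birep_tlin A B : A *m B = 1%:M ->
  exists u, fwd u = tlin A /\ bwd u = tlin B.
Proof.
move=> AB; have BA := mulmx1C AB.
suff H : let u := (tlin A, tlin B) in
    [&& is_ratmap u.1, is_ratmap u.2, comp_is_id u.1 u.2 & comp_is_id u.2 u.1].
  by exists (Birep H).
by rewrite /= (tlin_ratmap BA) (tlin_ratmap AB) !comp_is_id_tlin.
Qed.

End Evaluation.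

(** * Points in general position *)

Section General.
Variable k : closedFieldType.
Implicit Types (f g : birep k) (x y z v : 'rV[k]_3).

Lemma polyfun_ev (f : triple k) i : polyfun (fun v => ev f v 0 i).
Proof. by exists (tnth f i) => v; rewrite mxE. Qed.

Lemma polyfun_det (X Y Z : 'rV[k]_3 -> 'rV[k]_3) :
    (forall i, polyfun (fun v => X v 0 i)) ->
    (forall i, polyfun (fun v => Y v 0 i)) ->
    (forall i, polyfun (fun v => Z v 0 i)) ->
  polyfun (fun v => \det (frame (X v) (Y v) (Z v))).
Proof.
move=> pX pY pZ; pose d3 v : k :=
  X v 0 0 * (Y v 0 1 * Z v 0 2%:R - Y v 0 2%:R * Z v 0 1)
  - X v 0 1 * (Y v 0 0 * Z v 0 2%:R - Y v 0 2%:R * Z v 0 0)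
  + X v 0 2%:R * (Y v 0 0 * Z v 0 1 - Y v 0 1 * Z v 0 0).
have [p pE] : polyfun d3.
  by rewrite /d3; do ![exact: pX | exact: pY | exact: pZ
      | apply: polyfunB | apply: polyfunD | apply: polyfunM].
by exists p => v; rewrite det_frame -pE.
Qed.

(** [phi] is a nonzero 2 by 2 minor of [fwd f] against the identity triple. *)
Lemma polyfun_moving f : ~~ birep_eq f (birep1 k) ->
  exists phi : 'rV[k]_3 -> k, [/\ polyfun phi, exists v, phi v != 0 &
    forall v, phi v != 0 -> ~ parallel v (ev (fwd f) v)].
Proof.
case/forallPn=> i /forallPn[j]; rewrite -subr_eq0 => /mpoly_nonroot_row[v nz].
set P : {mpoly k[3]} := (X in X.@[v 0]) in nz.
exists (fun v => P.@[v 0]); split; [exact: polyfun_meval | by exists v |].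
move=> w /eqP nz' /(_ i j); rewrite !mxE => E; case: nz'.
rewrite /P mevalB !mevalM !tnth_mktuple !mevalXU.
by apply/eqP; rewrite subr_eq0 mulrC -E mulrC.
Qed.

(** The image of [f] lies on no line: a generic point [v] off the line is, up to a nonzero scalar,
    the image of [ev (bwd f) v]. *)
Lemma ev_dominant f x y : ~ parallel x y ->
  exists v, \det (frame x y (ev (fwd f) v)) != 0.
Proof.
case/frame_completion=> z nz; have [c nz_c cE] := ev_comp_is_id (bwdK f).
have [w nz_w] := mpoly_nonroot_row nz_c.
have [||||v [nz1 nz2]] :=
  @polyfun_nonroot2 _ _ (fun v => \det (frame x y v)) (fun v => c.@[v 0]).
- by apply: polyfun_det => i; last exact: polyfun_coord; exact: polyfun_cst.
- exact: polyfun_meval.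
- by exists z.
- by exists w.
exists (ev (bwd f) v); apply/eqP => det0.
have := det_frameZ x y (ev (fwd f) (ev (bwd f) v)) (v 0 0).
rewrite cE det_frameZ det0 mulr0 => /eqP.
by rewrite mulf_eq0 (negPf nz1) (negPf nz2).
Qed.

(** The conditions say that q, g(q), q' is a basis in which g(q') has nonzero coordinates along q'
    and along g(q). *)
Lemma general_position g : ~~ birep_eq g (birep1 k) ->
  exists q q', let G := ev (fwd g) in
    [/\ \det (frame q (G q) q') != 0, \det (frame q (G q) (G q')) != 0 &
        \det (frame q q' (G q')) != 0].
Proof.
case/polyfun_moving=> phi [pphi phi_nz phi_moves]; set G := ev _.
have pG i : polyfun (fun v => G v 0 i) by exact: polyfun_ev.
have pc (x : 'rV[k]_3) i : polyfun (fun _ : 'rV[k]_3 => x 0 i).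
  exact: polyfun_cst.
have px (i : 'I_3) : polyfun (fun v : 'rV[k]_3 => v 0 i).
  exact: polyfun_coord.
(* Taking q off the line joining [v0] to its image makes the third determinant nonzero at [v0],
   hence at a generic q'. *)
have [v0 /phi_moves/frame_completion[z nz_z]] := phi_nz.
have [||//||q [/phi_moves npar nz_q]] :=
  @polyfun_nonroot2 _ _ phi (fun q => \det (frame q v0 (G v0))).
- exact: pphi.
- exact: polyfun_det.
- by exists z; rewrite det_frame_rot.
have [z1 nz_z1] := frame_completion npar.
have [z2 nz_z2] := ev_dominant g npar.
have [||||v1 [nz1 nz2]] := @polyfun_nonroot2 _ _
   (fun v => \det (frame q (G q) v)) (fun v => \det (frame q (G q) (G v))).
- exact: polyfun_det.
- exact: polyfun_det.
- by exists z1.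
- by exists z2.
have [||||q' [nz12 nz3]] := @polyfun_nonroot2 _ _
   (fun v => \det (frame q (G q) v) * \det (frame q (G q) (G v)))
   (fun v => \det (frame q v (G v))).
- by apply: polyfunM; exact: polyfun_det.
- exact: polyfun_det.
- by exists v1; rewrite mulf_neq0.
- by exists v0.
by exists q, q'; move: nz12; rewrite mulf_eq0 negb_or => /andP[].
Qed.

End General.

(** * Maps commuting with all conjugates of a nontrivial map *)

Section Main.
Variable k : closedFieldType.
Implicit Types (f g u : birep k).

Lemma closed_neq01 : exists m : k, m != 0 /\ m != 1.
Proof.
have : 'X * ('X - 1%:P) != 0 :> {poly k}.
  by rewrite mulf_neq0 ?polyX_eq0 ?polyXsubC_eq0.
case/closed_nonrootP=> m; rewrite rootM rootX root_XsubC negb_or => /andP[].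
by exists m.
Qed.

Lemma commute_ev f g (A H : 'M[k]_3) p : H *m A = 1%:M ->
    (forall u, birep_eq (birepM f (birepM (birepV u) (birepM g u)))
                        (birepM (birepM (birepV u) (birepM g u)) f)) ->
  parallel (ev (fwd f) (ev (fwd g) (p *m H) *m A))
           (ev (fwd g) (ev (fwd f) p *m H) *m A).
Proof.
case/birep_tlin=> u [uH uA] /(_ u)/(@ev_proportional _ _ _ p).
have fwdM v w : fwd (birepM v w) = tcomp (fwd v) (fwd w) by [].
have fwdV v : fwd (birepV v) = bwd v by [].
by rewrite !(fwdM, fwdV) uH uA !ev_tcomp !ev_tlin.
Qed.

Lemma commute_conj_trivial f g : ~~ birep_eq g (birep1 k) ->
    (forall u, birep_eq (birepM f (birepM (birepV u) (birepM g u)))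
                        (birepM (birepM (birepV u) (birepM g u)) f)) ->
  birep_eq f (birep1 k).
Proof.
move=> /general_position[q [q' /=]]; set G := ev _ => -[nz nzb nzc] fg.
apply/negPn/negP => /polyfun_moving[phi [_ [p /[swap]/[apply]]]].
set F := ev (fwd f); set p' := F p => npar.
have [r [nzr nzFr]] : exists r, \det (frame p r p') != 0 /\ F r != 0.
  have [z nz_z] := frame_completion npar.
  have /is_ratmapP[[i /mpoly_nonroot_row[w nz_w]] _] := fwdP f.
  have [||||r [nz1 nz2]] := @polyfun_nonroot2 _ _
     (fun v => \det (frame p v p')) (fun v => F v 0 i).
  - apply: polyfun_det => j; [|exact: polyfun_coord|]; exact: polyfun_cst.
  - exact: polyfun_ev.
  - by exists z; rewrite det_frame_swap oppr_eq0.
  - by exists w; rewrite mxE.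
  by exists r; split=> //; apply: contraNneq nz2 => ->; rewrite mxE eqxx.
have [a [c [b Gq']]] := frame_coord (G q') nz.
have [x [z [y Fr]]] := frame_coord (F r) nzr.
(* By Cramer's rule, [b] and [c] are, up to sign, quotients of the second and third determinants by
   the first. *)
have b_neq0 : b != 0.
  apply: contraNneq nzb => b0.
  by rewrite Gq' b0 !det_frame !mxE; apply/eqP; ring.
have c_neq0 : c != 0.
  apply: contraNneq nzc => c0.
  by rewrite Gq' c0 !det_frame !mxE; apply/eqP; ring.
have key m : m != 0 -> exists t, [/\ x = t * a, z = t * c & y = t * (b * m)].
  move=> nzm.
  have [d Gd] : exists d, forall s v, G (s *: v) = s ^+ d *: G v.
    exact: ev_homog (fwdP g).
  pose B := frame q (G q) q'; pose C := frame p r (m *: p').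
  have nzC : \det C != 0 by rewrite det_frameZ mulf_neq0.
  have HA : (invmx C *m B) *m (invmx B *m C) = 1%:M.
    by rewrite mulmxA mulmxK ?mulVmx // unitmxE unitfE.
  have fromB a1 b1 c1 :=
    @mul_frame_change _ q (G q) q' p r (m *: p') a1 b1 c1 nz.
  have fromC a1 b1 c1 :=
    @mul_frame_change _ p r (m *: p') q (G q) q' a1 b1 c1 nzC.
  have pH : p *m (invmx C *m B) = q.
    by have := fromC 1 0 0; rewrite !scale1r !scale0r !addr0.
  have GqA : G q *m (invmx B *m C) = r.
    by have := fromB 0 1 0; rewrite !scale1r !scale0r !addr0 !add0r.
  have p'H : p' *m (invmx C *m B) = m^-1 *: q'.
    have := fromC 0 0 m^-1.
    by rewrite !scale0r !add0r scalerA mulVf // scale1r.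
  (* The inverse matrix sends p to q and p' to a multiple of q', so commutation at p compares F(r)
     with a multiple of the transported G(q'). *)
  have := commute_ev p HA fg; rewrite -/G -/F -/p' pH GqA p'H Gd.
  rewrite -scalemxAl Gq' fromB => /parallelZr.
  rewrite expf_neq0 ?invr_neq0 // => /(_ isT)/parallelP[|t].
    (* The transported G(q') is nonzero because its r-coordinate is [c]. *)
    apply/eqP => /(frame_inj nzC)[_ c0 _].
    by rewrite c0 eqxx in c_neq0.
  rewrite Fr !scalerDr !scalerA => E; exists t.
  have [||/subr0_eq-> /subr0_eq-> /subr0_eq->//] :=
    @frame_inj _ p r p' (x - t * a) (z - t * c) (y - t * (b * m)) => //.
  apply/rowP=> l; move/rowP/(_ l): E; rewrite !mxE => /eqP.
  by rewrite -subr_eq0 => /eqP <-; ring.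
have [m [m0 m1]] := closed_neq01.
have [t [xta ztc ytb]] := key 1 (oner_neq0 _).
have [s [_ zsc ysb]] := key m m0.
(* The r-coordinate fixes the scalar independently of [m]; the p'-coordinate then forces it to be 0,
   so F(r) would vanish. *)
have st : s = t by apply: (mulIf c_neq0); rewrite -zsc.
have t0 : t = 0.
  apply/eqP; move: ysb; rewrite ytb st mulr1 => /eqP; rewrite -subr_eq0.
  have -> : t * b - t * (b * m) = - (t * b * (m - 1)) by ring.
  by rewrite oppr_eq0 !mulf_eq0 (negPf b_neq0) subr_eq0 (negPf m1) !orbF.
by rewrite Fr xta ztc ytb t0 !mul0r !scale0r !addr0 eqxx in nzFr.
Qed.

End Main.

Theorem proposition16 (k : closedFieldType) (G : Bir k -> Prop) :
  normal_subgroup G -> nontrivial G ->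
  forall f : Bir k, centralizer G f <-> f = 1%g.
Proof.
move=> [_ conjG] [g Gg g_neq1] f; split=> [cGf|-> h _]; last first.
  by rewrite monoid.mul1g monoid.mulg1.
have eq1P (h : Bir k) : reflect (h = 1%g) (birep_eq (repr h) (birep1 k)).
  by rewrite -[in X in reflect X _](reprK h); exact: Bir_eqP.
have ng : ~~ birep_eq (repr g) (birep1 k) by apply/eq1P.
apply/eq1P/(commute_conj_trivial ng) => u; apply/Bir_eqP.
(* In the quotient group the goal says that [f] commutes with a conjugate of [g], which lies in [G]
   by normality. *)
pose pi (v : birep k) : Bir k := (\pi_(Bir k) v)%qT.
have piM v w : pi (birepM v w) = (pi v * pi w)%g by exact/esym/birME.
have piV v : pi (birepV v) = (pi v)^-1%g by exact/esym/birVE.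
rewrite -!/(pi _) !(piM, piV) /pi !reprK -conjgE; exact/cGf/conjG.
Qed.
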